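(* Let $(X,\mathcal F,P)$ be a non-atomic probability space, let $\mathcal A\subseteq\mathcal F$ be a sub-$\sigma$-algebra, and let $v_{\mathcal A}$ be the capacity induced by $\mathcal A$. The following are equivalent: 1. for every $F\in\mathcal F$ with $v_{\mathcal A}(F)>0$ and every sequence $\{F_n\}_n\subset\mathcal F$ increasing to $F$ (i.e. $F_1\subseteq F_2\subseteq\cdots$ and $\bigcup_n F_n=F$) there is $n$ such that $v_{\mathcal A}(F_n)>0$; 2. $\lim_n\int_X f_n\,dv_{\mathcal A}=\int_X f\,dv_{\mathcal A}$ for every increasing sequence $\{f_n\}_n\subset\mathcal M$ converging strongly $v_{\mathcal A}$-a.e. to a function $f\in\mathcal M$; 3. $\lim_n\int_X f_n\,dv_{\mathcal A}=\int_X f\,dv_{\mathcal A}$ for every increasing sequence $\{f_n\}_n\subset\mathcal M$ converging pointwise to a function $f\in\mathcal M$; 4. $v_{\mathcal A}$ is continuous from below.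
   Context: $\mathcal M$ is the collection of all nonnegative $\mathcal F$-measurable functions on $X$. An atom of the probability space is a set $F\in\mathcal F$ with $P(F)>0$ such that every $G\in\mathcal F$ with $G\subseteq F$ has $P(G)=P(F)$ or $P(G)=0$; the space is non-atomic if it has no atoms. The capacity induced by $\mathcal A$ is $v_{\mathcal A}(F)=\max\{P(A): A\in\mathcal A, A\subseteq F\}$, $F\in\mathcal F$ (the maximum is attained; writing $A_F\in\mathcal A$ for a maximizer, $v_{\mathcal A}(F)=P(A_F)$). $\int_X f\,dv_{\mathcal A}$ is the Choquet integral $\int_0^\infty v_{\mathcal A}(\{x: f(x)\ge t\})\,dt\in[0,\infty]$; since $v_{\mathcal A}$ is convex (i.e. $v_{\mathcal A}(F)+v_{\mathcal A}(E)\le v_{\mathcal A}(F\cup E)+v_{\mathcal A}(F\cap E)$), it coincides with the concave integral $\sup\{\sum_{i=1}^N\lambda_i v_{\mathcal A}(F_i):\sum_{i=1}^N\lambda_i\mathbf 1_{F_i}\le f, F_i\in\mathcal F,\lambda_i\ge0, N\in\mathbb N\}$. A sequence $\{f_n\}_n$ is increasing if $f_n\le f_{n+1}$ pointwise for all $n$. $\{f_n\}_n$ converges to $f$ strongly $v_{\mathcal A}$-a.e. if $v_{\mathcal A}(\{x\in F: f_n(x)\to f(x)\})=v_{\mathcal A}(F)$ for all $F\in\mathcal F$. $v_{\mathcal A}$ is continuous from below if $\lim_n v_{\mathcal A}(F_n)=v_{\mathcal A}(\bigcup_n F_n)$ for every increasing sequence $F_1\subseteq F_2\subseteq\cdots$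 in $\mathcal F$. *)

(* Defs.v *)
(* MathComp-Analysis *)
From HB Require Import structures.
From mathcomp Require Import all_boot all_order all_algebra.
From mathcomp Require Import all_classical all_reals all_analysis.
Set Implicit Arguments.
Unset Strict Implicit.
Unset Printing Implicit Defensive.
Import Order.TTheory GRing.Theory Num.Theory.
Import numFieldNormedType.Exports.
Local Open Scope classical_set_scope.
Local Open Scope ring_scope.
Local Open Scope ereal_scope.

Definition atom (d : measure_display) (T : measurableType d) (R : realType)
    (P : probability T R) (F : set T) : Prop :=
  [/\ measurable F, 0 < P F &
      forall G, measurable G -> G `<=` F -> P G = P F \/ P G = 0].

Definition non_atomic (d : measure_display) (T : measurableType d)
    (R : realType) (P : probability T R) : Prop :=
  forall F, ~ atom P F.

Definition is_sub_sigma_algebra (d : measure_display) (T : measurableType d)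
    (A : set (set T)) : Prop :=
  sigma_algebra [set: T] A /\ A `<=` measurable.

(* The supremum is attained when A is a sub-sigma-algebra:
   see induced_capacity_max below. *)
Definition induced_capacity (d : measure_display) (T : measurableType d)
    (R : realType) (P : probability T R) (A : set (set T)) (F : set T) : \bar R :=
  ereal_sup [set P B | B in [set B | A B /\ B `<=` F]].

Lemma induced_capacity_max (d : measure_display) (T : measurableType d)
    (R : realType) (P : probability T R) (A : set (set T)) (F : set T) :
  is_sub_sigma_algebra A ->
  exists2 B, A B /\ B `<=` F & induced_capacity P A F = P B.
Proof.
move=> [[A0 AC AU] Am].
set S := [set P B | B in [set B | A B /\ B `<=` F]].
have S0 : S != set0.
  by apply/set0P; exists (P set0), set0 => //; split=> //; exact: sub0set.
have [u uS ucvg] := ereal_sup_seq S0.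
have /choice[B_ HB] : forall n, exists B, (A B /\ B `<=` F) /\ P B = u n.
  by move=> n; have [B ? <-] := uS n; exists B.
have AB : A (\bigcup_n B_ n) by apply: AU => n; case: (HB n) => -[].
have BF : \bigcup_n B_ n `<=` F.
  by apply: bigcup_sub => n _; have [[]] := HB n.
exists (\bigcup_n B_ n) => //; apply/eqP; rewrite eq_le; apply/andP; split.
  rewrite /induced_capacity -/S -(cvg_lim _ ucvg)//.
  apply: lime_le; first by apply/cvg_ex; exists (ereal_sup S).
  apply: nearW => n; have [[ABn _] <-] := HB n.
  by apply: le_measure; rewrite ?inE; [exact: Am|exact: Am|exact: bigcup_sup].
by apply: ereal_sup_ubound; exists (\bigcup_n B_ n).
Qed.

(* For a monotone v with values in [0, 1] the integrand is nonincreasing and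
   nonnegative, so this Lebesgue integral is the improper Riemann integral. *)
Definition choquet_integral (d : measure_display) (T : measurableType d)
    (R : realType) (v : set T -> \bar R) (f : T -> R) : \bar R :=
  \int[lebesgue_measure]_(t in `[0%R, +oo[) v [set x | (t <= f x)%R].

Definition nonneg_measurable (d : measure_display) (T : measurableType d)
    (R : realType) : set (T -> R) :=
  [set f : T -> R | measurable_fun [set: T] f /\ forall x, (0 <= f x)%R].

Definition increasing_sets (T : Type) (F : nat -> set T) : Prop :=
  forall n, F n `<=` F n.+1.

Definition increasing_funs (T : Type) (R : realType) (f : nat -> T -> R) : Prop :=
  forall n x, (f n x <= f n.+1 x)%R.

Definition strong_ae_cvg (d : measure_display) (T : measurableType d)
    (R : realType) (v : set T -> \bar R) (f_ : nat -> T -> R) (f : T -> R) : Prop :=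
  forall F, measurable F ->
    v (F `&` [set x | f_ n x @[n --> \oo] --> f x]) = v F.

Definition continuous_from_below (d : measure_display) (T : measurableType d)
    (R : realType) (v : set T -> \bar R) : Prop :=
  forall F : nat -> set T, (forall n, measurable (F n)) -> increasing_sets F ->
    v (F n) @[n --> \oo] --> v (\bigcup_n F n).

(* Main.v *)
Require Import Defs.
From HB Require Import structures.
From mathcomp Require Import all_boot all_order all_algebra.
From mathcomp Require Import all_classical all_reals all_analysis.
From mathcomp Require Import measurable_realfun.
Set Implicit Arguments.
Unset Strict Implicit.
Unset Printing Implicit Defensive.
Import Order.TTheory GRing.Theory Num.Theory.
Import numFieldNormedType.Exports.
Local Open Scope classical_set_scope.
Local Open Scope ring_scope.
Local Open Scope ereal_scope.

(** The substance is in two implications, which together give everything out of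
    the first condition; the others are specializations.

    From the first condition to continuity from below
    ([capacity_continuous_from_below]).  Let [F_ n] increase to [F], let [B_ n]
    and [C] be members of the sigma-algebra realizing the capacities of [F_ n]
    and [F], and put [D = C \ \bigcup_n B_ n].  If [D] had positive
    probability, the first condition applied to the sets [F_ n `&` D], which
    increase to [D], would give an [n] and a non-null member [E] of the
    sigma-algebra inside [F_ n `&` D].  As [E] avoids [B_ n], the set
    [B_ n `|` E] would be contained in [F_ n] and more probable than the
    maximizer [B_ n].  Hence [D] is null, so the capacity of [F] is at most
    the probability of [\bigcup_n B_ n], which is the limit of the capacities
    of the [F_ n].

    From continuity from below to strong monotone convergence
    ([choquet_integral_cvg]).  For fixed [t] the sets [f_ n >= t] increase to a
    set [G t]; intersecting with the points of convergence, which by hypothesis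
    does not change capacities, gives [v (f > t) <= v (G t) <= v (f >= t)].
    The two bounds are nonincreasing in [t] and [v (f >= t) <= v (f > s)] for [s < t], so
    they differ for countably many [t] only ([countable_monotone_gap]), and the monotone
    convergence theorem for the Lebesgue measure in [t] concludes.

    Strong convergence contains pointwise convergence.  The pointwise
    statement, read on indicator functions, whose Choquet integral is the
    capacity of the set ([choquet_integral_indic]), is continuity from below;
    and along a sequence of sets of capacity zero, continuity from below forces
    the union to have capacity zero, which is the first condition. *)

(** * Choquet integrals of monotone set functions *)

(** The intervals [`]k t, h t[] attached to distinct points are disjoint, and a
    rational number chosen in each nonempty one identifies the point.  With
    [k] and [h] the one-sided limits of a nonincreasing function this is the
    countability of its jumps. *)
Lemma countable_monotone_gap (R : realType) (h k : R -> R) :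
  (forall s t, (s < t)%R -> (h t <= k s)%R) ->
  countable [set t | (k t < h t)%R].
Proof.
move=> hk.
have /choice[q qP] : forall t, exists q : rat,
    (k t < h t)%R -> ratr q \in `]k t, h t[%R.
  move=> t; have [/rat_in_itvoo[q qt]|_] := ltP (k t) (h t); first by exists q.
  by exists 0%R.
apply/countable_injP; exists (pickle \o q) => s t; rewrite !inE /= => ks kt.
move=> /(pcan_inj pickleK) qst; apply/eqP; rewrite eq_le !leNgt.
wlog suff main : s t ks kt qst / ~~ (s < t)%R.
  by rewrite main// main.
apply/negP => /hk; rewrite leNgt => /negP; apply.
have := qP s ks; rewrite qst in_itv /= => /andP[ksq _].
have := qP t kt; rewrite in_itv /= => /andP[_]; exact: lt_trans.
Qed.

(** The integrand of the Choquet integral is nonincreasing, hence Borel. *)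
Lemma measurable_survival (T : Type) (R : realType) (v : set T -> \bar R)
    (f : T -> R) (D : set R) :
  {homo v : E F / E `<=` F >-> E <= F} -> (forall E, v E \is a fin_num) ->
  measurable D ->
  measurable_fun D ((fun t => v [set x | (t <= f x)%R]) : R -> \bar R).
Proof.
move=> vmono vfin mD.
rewrite (_ : (fun t => _) = EFin \o (fun t => fine (v [set x | (t <= f x)%R]))).
  apply/measurable_EFinP.
  apply: nonincreasing_measurable => // s t st.
  by apply: fine_le => //; apply: vmono => x /=; exact: le_trans.
by apply/funext => t /=; rewrite fineK.
Qed.

(** At each level [t] continuity from below gives the limit of the integrands,
    which is the limit integrand outside its countably many jumps.  The
    functions [f_ n] need not be below [f] outside the set of convergence; strong
    a.e. convergence is used as the possibility of restricting to that set
    inside any measurable set. *)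
Lemma choquet_integral_cvg (d : measure_display) (T : measurableType d)
    (R : realType) (v : set T -> \bar R) (f_ : nat -> T -> R) (f : T -> R) :
  {homo v : E F / E `<=` F >-> E <= F} -> (forall E, v E \is a fin_num) ->
  (forall E, 0 <= v E) -> continuous_from_below v ->
  (forall n, measurable_fun setT (f_ n)) -> measurable_fun setT f ->
  increasing_funs f_ -> strong_ae_cvg v f_ f ->
  choquet_integral v (f_ n) @[n --> \oo] --> choquet_integral v f.
Proof.
move=> vmono vfin v0 vcont mf_ mf f_incr f_cvg.
have mge (g : T -> R) t : measurable_fun setT g ->
    measurable [set x | (t <= g x)%R].
  move=> mg; have := mg measurableT _ (measurable_itv `[t, +oo[).
  by rewrite setTI preimage_itvcy.
have mgt (g : T -> R) t : measurable_fun setT g ->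
    measurable [set x | (t < g x)%R].
  move=> mg; have := mg measurableT _ (measurable_itv `]t, +oo[).
  by rewrite setTI preimage_itvoy.
have f_homo x : {homo f_^~ x : n m / (n <= m)%N >-> (n <= m)%R}.
  by apply/nondecreasing_seqP => n; exact: f_incr.
pose h n t := v [set x | (t <= f_ n x)%R].
pose G t := \bigcup_n [set x | (t <= f_ n x)%R].
have mG t : measurable (G t) by apply: bigcup_measurable => n _; exact: mge.
have h_cvg t : h n t @[n --> \oo] --> v (G t).
  apply: vcont => [n|n x]; first exact: mge.
  by move=> /= /le_trans; apply; exact: f_incr.
(* On the points of convergence an increasing sequence stays below its limit. *)
have G_le t : v (G t) <= v [set x | (t <= f x)%R].
  rewrite -(f_cvg _ (mG t)); apply: vmono => x [[n _ /= tn] fx].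
  apply: (le_trans tn); rewrite -(cvg_lim _ fx)//.
  by apply: nondecreasing_cvgn_le; [exact: f_homo|apply/cvg_ex; exists (f x)].
(* On the points of convergence [t < f x] forces [t < f_ n x] for some [n]. *)
have G_ge t : v [set x | (t < f x)%R] <= v (G t).
  rewrite -(f_cvg _ (mgt _ t mf)); apply: vmono => x [/= tx fx].
  have [n _ /(_ n (leqnn n)) /= tn] := cvgr_gt _ fx _ tx.
  by exists n => //=; exact: ltW.
rewrite /choquet_integral.
have mI : measurable (`[0%R, +oo[%classic : set R) by exact: measurable_itv.
have mh n : measurable_fun (`[0%R, +oo[%classic : set R) (h n).
  exact: measurable_survival.
have h_homo t : {homo h^~ t : n m / (n <= m)%N >-> n <= m}.
  by move=> n m nm; apply: vmono => x /= /le_trans; apply; exact: f_homo.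
have := @cvg_monotone_convergence _ _ _ lebesgue_measure _ mI _ mh
  (fun n t _ => v0 _) (fun t _ => h_homo t).
have limE t : limn (h^~ t) = v (G t) by exact: cvg_lim.
suff -> : \int[lebesgue_measure]_(t in `[0%R, +oo[) limn (h^~ t) =
    \int[lebesgue_measure]_(t in `[0%R, +oo[) v [set x | (t <= f x)%R] by [].
apply: ae_eq_integral => //.
- apply: (emeasurable_fun_cvg h) => // t _.
  by rewrite limE.
- exact: measurable_survival.
pose J := [set t | (fine (v [set x | (t < f x)%R]) <
                    fine (v [set x | (t <= f x)%R]))%R].
have cJ : countable J.
  apply: countable_monotone_gap => s t st; apply: fine_le => //.
  by apply: vmono => x /=; exact: lt_le_trans.
exists J; split; [exact: countable_measurable|exact: countable_lebesgue_measure0|].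
move=> t /= /not_implyP[_] ne; rewrite /J /= ltNge; apply/negP => le; apply: ne.
rewrite limE; apply/eqP; rewrite eq_le G_le /=.
by apply: le_trans (G_ge t); rewrite -(fineK (vfin _)) -[leRHS](fineK (vfin _)) lee_fin.
Qed.

(** The level sets of an indicator function are [F] for [t] in [`]0, 1]] and
    empty beyond 1; at [t = 0] the level set is the whole space, which is why
    that point is removed first. *)
Lemma choquet_integral_indic (d : measure_display) (T : measurableType d)
    (R : realType) (v : set T -> \bar R) (F : set T) :
  {homo v : E F / E `<=` F >-> E <= F} -> (forall E, v E \is a fin_num) ->
  v set0 = 0 -> choquet_integral v \1_F = v F.
Proof.
move=> vmono vfin v0; rewrite /choquet_integral -integral_itv_obnd_cbnd; last first.
  exact: measurable_survival.
transitivity (\int[lebesgue_measure]_(t in `]0%R, +oo[)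
    ((cst (v F)) \_ (`]0%R, 1%R] : set R)) t).
  apply: eq_integral => t; rewrite inE /= in_itv /= andbT => t0.
  rewrite patchE; case: ifPn => [|/negP]; rewrite inE /= in_itv /= t0 /= => t1.
    congr (v _); apply/seteqP; split => x /=; rewrite indicE.
      by case: (boolP (x \in F)) => [/set_mem//|_]; rewrite leNgt t0.
    by move=> Fx; rewrite mem_set.
  transitivity (v set0); last exact: v0.
  congr (v _); rewrite -subset0 => x /= tx; apply: t1.
  by apply: le_trans tx _; rewrite indicE; case: (x \in F).
rewrite -integral_mkcondr setIidr; last first.
  by move=> t /=; rewrite !in_itv /= => /andP[->].
by rewrite integral_cst//= lebesgue_measure_itv /= lte_fin ltr01 oppr0 adde0 mule1.
Qed.

(** * Continuity from below of an induced capacity *)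

Lemma increasing_sets_le (T : Type) (F : nat -> set T) m n :
  increasing_sets F -> (m <= n)%N -> F m `<=` F n.
Proof.
move=> F_incr mn; apply/subsetPset; move: mn.
by apply: (nondecreasing_seqP F).1 => k; apply/subsetPset; exact: F_incr.
Qed.

Lemma capacity_mono (d : measure_display) (T : measurableType d)
    (R : realType) (P : probability T R) (A : set (set T)) :
  {homo induced_capacity P A : E F / E `<=` F >-> E <= F}.
Proof.
move=> E F EF; apply: ereal_sup_le => _ [B [AB BE] <-].
exists B => //; split => //; exact: subset_trans EF.
Qed.

Lemma capacity_bounds (d : measure_display) (T : measurableType d)
    (R : realType) (P : probability T R) (A : set (set T)) E :
  is_sub_sigma_algebra A -> 0 <= induced_capacity P A E <= 1.
Proof.
move=> subA; have [B [AB _] ->] := induced_capacity_max P E subA.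
by rewrite measure_ge0 probability_le1//; exact: subA.2.
Qed.

Lemma capacity_ge (d : measure_display) (T : measurableType d)
    (R : realType) (P : probability T R) (A : set (set T)) B E :
  A B -> B `<=` E -> P B <= induced_capacity P A E.
Proof. by move=> AB BE; apply: ereal_sup_ubound; exists B. Qed.

Lemma capacity_mem (d : measure_display) (T : measurableType d)
    (R : realType) (P : probability T R) (A : set (set T)) B :
  is_sub_sigma_algebra A -> A B -> induced_capacity P A B = P B.
Proof.
move=> [_ Am] AB; apply/eqP; rewrite eq_le; apply/andP; split.
  apply: ge_ereal_sup => _ [C [AC CB] <-].
  by apply: le_measure; rewrite ?inE//; exact: Am.
exact: capacity_ge.
Qed.

(** What the capacity of the limit set could gain over the union of the
    maximizers of the [F_ n] is a member [D] of the sigma-algebra; the hypothesis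
    applied to the traces of the [F_ n] on [D] shows that [D] is null, for otherwise
    some maximizer could be enlarged. *)
Lemma capacity_continuous_from_below (d : measure_display) (T : measurableType d)
    (R : realType) (P : probability T R) (A : set (set T)) :
  is_sub_sigma_algebra A ->
  (forall F : set T, measurable F -> 0 < induced_capacity P A F ->
    forall F_ : nat -> set T, (forall n, measurable (F_ n)) ->
      increasing_sets F_ -> \bigcup_n F_ n = F ->
      exists n, 0 < induced_capacity P A (F_ n)) ->
  continuous_from_below (induced_capacity P A).
Proof.
move=> subA pos F_ mF_ F_incr; set v := induced_capacity P A in pos *.
have [[A0 AC AU] Am] := subA.
have AD B C : A B -> A C -> A (B `\` C).
  move=> AB AC'.
  have subT X : A X -> X `<=` [set: T] by [].
  have [_ _ _ AI] := (sigma_algebraP subT).1 subA.1.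
  by rewrite setDE; apply: AI => //; rewrite -setTD; exact: AC.
have vhomo : {homo (v \o F_) : n m / (n <= m)%N >-> n <= m}.
  by apply/nondecreasing_seqP => n; exact: capacity_mono.
have vcvg := ereal_nondecreasing_cvgn vhomo.
rewrite (_ : v (\bigcup_n F_ n) = ereal_sup (range (v \o F_)))//.
apply/eqP; rewrite eq_le; apply/andP; split; last first.
  by apply: ge_ereal_sup => _ [n _ <-]; apply: capacity_mono; exact: bigcup_sup.
have /choice[B_ HB] : forall n, exists B, (A B /\ B `<=` F_ n) /\ v (F_ n) = P B.
  by move=> n; have [B] := induced_capacity_max P (F_ n) subA; exists B.
have AB_ n : A (B_ n) by case: (HB n) => -[].
have BF_ n : B_ n `<=` F_ n by case: (HB n) => -[].
have vB n : v (F_ n) = P (B_ n) by case: (HB n).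
have [C [AC' CF]] := induced_capacity_max P (\bigcup_n F_ n) subA.
rewrite -/v => ->.
pose D := C `\` \bigcup_n B_ n.
have AD' : A D by apply: AD => //; exact: AU.
have PD0 : P D = 0.
  apply/eqP; rewrite eq_le measure_ge0 andbT leNgt; apply/negP => PD.
  have [|||||n] := pos D _ _ (fun n => F_ n `&` D).
  - exact: Am.
  - by rewrite /v capacity_mem.
  - by move=> n; apply: measurableI => //; exact: Am.
  - by move=> n; apply: setSI; exact: F_incr.
  - rewrite -setI_bigcupl; apply/setIidPr => x [Cx _]; exact: CF.
  have [E [AE ED]] := induced_capacity_max P (F_ n `&` D) subA.
  rewrite -/v => ->.
  apply/negP; rewrite -leNgt.
  (* [B_ n `|` E] competes with the maximizer [B_ n] inside [F_ n]. *)
  have : P (B_ n `|` E) <= P (B_ n).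
    rewrite -vB; apply: capacity_ge; last first.
      by rewrite subUset; split=> [|x /ED[]//]; exact: BF_.
    rewrite -bigcup2E; apply: AU => i; rewrite /bigcup2.
    by do 2?case: ifP.
  rewrite measureU; [|exact: Am|exact: Am|]; last first.
    by rewrite -subset0 => x [Bx /ED[_ [_]]]; apply; exists n.
  by rewrite -leeBrDl ?subee ?fin_num_measure//; exact: Am.
(* The maximizers [B_ n] need not increase with [n], but the union [U n] of the
   first of them does; truncating the index writes it as a countable union,
   under which the sigma-algebra is closed. *)
pose U n := \bigcup_k B_ (minn k n).
have AU_ n : A (U n) by apply: AU => k.
have UF n : U n `<=` F_ n.
  apply: bigcup_sub => k _; apply: subset_trans (BF_ _) _.
  exact: increasing_sets_le (geq_minr k n).
have U_homo : {homo U : n m / (n <= m)%N >-> (n <= m)%O}.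
  move=> n m nm; apply/subsetPset => x [k _ Bx]; exists (minn k n) => //.
  by rewrite (minn_idPl _)// (leq_trans _ nm)// geq_minr.
have UB : \bigcup_n B_ n `<=` \bigcup_n U n.
  by move=> x [n _ Bx]; exists n => //; exists n => //; rewrite minnn.
have mU : measurable (\bigcup_n U n) by apply: bigcup_measurable => n _; exact: Am.
have PCU : P C <= P (\bigcup_n U n).
  rewrite -[leRHS]add0e -PD0.
  apply: (le_trans (le_measure _ _ _ (_ : C `<=` D `|` \bigcup_n U n))).
  - by rewrite inE; exact: Am.
  - by rewrite inE; apply: measurableU => //; exact: Am.
  - by move=> x Cx; have [/UB|nB] := pselect ((\bigcup_n B_ n) x); [right|left].
  - by apply: measureU2 => //; exact: Am.
apply: (le_trans PCU).
have PU := nondecreasing_cvg_mu (mu := P) (fun n => Am _ (AU_ n)) mU U_homo.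
rewrite -(cvg_lim _ PU)//; apply: lime_le; first by apply/cvg_ex; eexists; exact: PU.
apply: nearW => n; apply: le_trans (capacity_ge P (AU_ n) (UF n)) _.
by apply: ereal_sup_ubound; exists n.
Qed.

(** * The equivalence *)

Theorem proposition3 (d : measure_display) (T : measurableType d) (R : realType)
    (P : probability T R) (A : set (set T))
    (Pna : non_atomic P) (subA : is_sub_sigma_algebra A) :
  let v := induced_capacity P A in
  [<->
    forall F : set T, measurable F -> 0 < v F ->
      forall F_ : nat -> set T, (forall n, measurable (F_ n)) ->
        increasing_sets F_ -> \bigcup_n F_ n = F ->
        exists n, 0 < v (F_ n);
    forall (f_ : nat -> T -> R) (f : T -> R),
      (forall n, nonneg_measurable (f_ n)) -> nonneg_measurable f ->
      increasing_funs f_ -> strong_ae_cvg v f_ f ->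
      choquet_integral v (f_ n) @[n --> \oo] --> choquet_integral v f;
    forall (f_ : nat -> T -> R) (f : T -> R),
      (forall n, nonneg_measurable (f_ n)) -> nonneg_measurable f ->
      increasing_funs f_ -> (forall x, f_ n x @[n --> \oo] --> f x) ->
      choquet_integral v (f_ n) @[n --> \oo] --> choquet_integral v f;
    continuous_from_below v].
Proof.
move=> v.
have vmono : {homo v : E F / E `<=` F >-> E <= F} by exact: capacity_mono.
have v0 E : 0 <= v E by case/andP: (capacity_bounds P E subA).
have vfin E : v E \is a fin_num.
  rewrite ge0_fin_numE//; have /andP[_] := capacity_bounds P E subA.
  by move=> /le_lt_trans; apply; exact: ltry.
have v_set0 : v set0 = 0.
  by rewrite /v capacity_mem ?measure0//; case: subA => -[].
tfae.
- move=> pos f_ f mf_ [mf _] f_incr f_cvg.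
  apply: choquet_integral_cvg => //; first exact: capacity_continuous_from_below.
  by move=> n; case: (mf_ n).
- move=> strong f_ f mf_ mf f_incr f_cvg; apply: strong => // F mF.
  by congr (v _); apply/setIidl => x _ /=; exact: f_cvg.
- move=> pointwise F_ mF_ F_incr.
  have indM F : measurable F -> nonneg_measurable (\1_F : T -> R).
    by move=> mF; split => //; exact: measurable_indic.
  have vE F : v F = choquet_integral v \1_F by rewrite choquet_integral_indic.
  rewrite vE; under eq_fun do rewrite vE.
  apply: pointwise.
  + by move=> n; exact: indM.
  + by apply: indM; exact: bigcup_measurable.
  + move=> n x; rewrite !indicE ler_nat.
    by case: (boolP (x \in F_ n)) => // /set_mem/F_incr/mem_set ->.
  + move=> x; apply: cvg_near_cst.
    have [[N _ FN]|nF] := pselect ((\bigcup_n F_ n) x).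
    * exists N => // n /= Nn; rewrite !indicE !mem_set//; first by exists N.
      exact: increasing_sets_le FN.
    * apply: nearW => n; rewrite !indicE !memNset// => Fx; apply: nF.
      by exists n.
- move=> cont F mF vF F_ mF_ F_incr UF; apply: contrapT => /forallNP allv0.
  have := cont F_ mF_ F_incr; rewrite UF.
  have vF0 n : v (F_ n) = 0.
    by apply/eqP; rewrite eq_le v0 andbT leNgt; apply/negP; exact: allv0.
  under eq_fun do rewrite vF0.
  move=> /(cvg_lim (@ereal_hausdorff R)); rewrite lim_cst// => vE.
  by move: vF; rewrite -vE ltxx.
Qed.
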